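(* The Hopf Lemma fails for the characteristic operator $\mathcal{T}$. Precisely: let $N\ge1$, $n=2N+1$, $R>0$, $B=B(0,R)\subseteq\mathbb{R}^n$, and let $$u(x)=-\sqrt{R^2-|x_n|^2},\qquad v(x)=-\sqrt{R^2-|x|^2}$$ (on $\overline B$). Let $D=\{x\in\mathbb{R}^n: x_2^2+\dots+x_n^2-x_1<0\}$, $\Omega=B\cap D$ and $p=(0,\dots,0)\in\partial\Omega$, and let $\nu=(1,0,\dots,0)$, which is the inner normal to $\partial\Omega$ at $p$. Then $$\mathcal{T}(u)\ge\mathcal{T}(v)\ \text{ in }\Omega,\qquad u<v\ \text{ in }\overline\Omega\setminus\{p\},\qquad u(p)=v(p),$$ and $$\frac{\partial u}{\partial\nu}(p)=\frac{\partial v}{\partial\nu}(p)=0 .$$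
   Context: Coordinates in $\mathbb{R}^n=\mathbb{R}^{2N+1}$ are $x=(x_1,\dots,x_n)$; the first $N$ are the ''$x$-variables'', the next $N$ are the ''$y$-variables'', and the last one $x_n$ is the variable $t$. For $q=(q_x,q_y,q_t)\in\mathbb{R}^N\times\mathbb{R}^N\times\mathbb{R}$ let $\sigma(q)=(-q_y,q_x,1)^T$ and $A(q)=\sigma(q)\sigma(q)^T$. The characteristic operator acts on $C^2$ functions $u$ by $$\mathcal{T}u=\frac{1}{(1+|Du|^2)^{3/2}}\operatorname{tr}\big(A(Du)\,D^2u\big).$$ The Hopf Lemma is the assertion that, if $\mathcal{T}(u)\ge\mathcal{T}(v)$ in $\Omega$, $u<v$ in $\overline\Omega\setminus\{p\}$ and $u(p)=v(p)$ with $p\in\partial\Omega$, then $\frac{\partial u}{\partial\nu}(p)<\frac{\partial v}{\partial\nu}(p)$, where $\nu$ is the inner normal to $\partial\Omega$ at $p$. *)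

(* Defs.v *)
From HB Require Import structures.
From mathcomp Require Import all_boot all_order all_algebra.
From mathcomp Require Import all_classical all_reals all_analysis.

Set Implicit Arguments.
Unset Strict Implicit.
Unset Printing Implicit Defensive.

Import Order.TTheory GRing.Theory Num.Theory.
Import numFieldNormedType.Exports.

Local Open Scope classical_set_scope.
Local Open Scope ring_scope.

(* The Euclidean norm: the library's norm on matrices is the sup norm. It
   induces the same topology, so the library's [open], [closure], [continuous]
   and derivatives are the usual ones on R^n. *)
Definition enorm (R : realType) (n : nat) (x : 'cV[R]_n) : R :=
  Num.sqrt (\sum_i x i 0 ^+ 2).

Definition eball (R : realType) (n : nat) (c : 'cV[R]_n) (r : R) :
    set 'cV[R]_n :=
  [set x | enorm (x - c) < r].

Definition boundary (T : topologicalType) (A : set T) : set T :=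
  closure A `\` interior A.

Definition basis_vec (R : realType) (n : nat) (i : 'I_n) : 'cV[R]_n :=
  delta_mx i 0.

Definition partial (R : realType) (n : nat) (i : 'I_n) (f : 'cV[R]_n -> R) :
    'cV[R]_n -> R :=
  fun x => 'D_(basis_vec R i) f x.

Definition grad (R : realType) (n : nat) (f : 'cV[R]_n -> R) (x : 'cV[R]_n) :
    'cV[R]_n :=
  \col_i partial i f x.

Definition hessian (R : realType) (n : nat) (f : 'cV[R]_n -> R)
    (x : 'cV[R]_n) : 'M[R]_n :=
  \matrix_(i, j) partial i (partial j f) x.

(* Meant for open [A]: derivatives at points of [A] then depend only on the
   values of [f] on [A]. Existence of the partial derivatives is required
   explicitly because ['D_v f x] is a total operator. *)
Definition C2_on (R : realType) (n : nat) (A : set 'cV[R]_n)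
    (f : 'cV[R]_n -> R) : Prop :=
  forall x, A x ->
    {for x, continuous f} /\
    forall i : 'I_n,
      [/\ derivable f x (basis_vec R i), {for x, continuous (partial i f)} &
        forall j : 'I_n,
          derivable (partial i f) x (basis_vec R j) /\
          {for x, continuous (partial j (partial i f))}].

(* A vector of R^(2N+1) is split into blocks as (q_x, q_y, q_t). *)
Section Coordinates.
Variables (R : realType) (N : nat).

Definition xpart (q : 'cV[R]_(N + N + 1)) : 'cV[R]_N := usubmx (usubmx q).
Definition ypart (q : 'cV[R]_(N + N + 1)) : 'cV[R]_N := dsubmx (usubmx q).

(* The indices of the coordinates x_1 and x_n, n = 2N+1. *)
Definition first_idx : 'I_(N + N + 1) := cast_ord (esym (addn1 (N + N))) ord0.
Definition last_idx : 'I_(N + N + 1) := rshift (N + N) ord0.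

Definition sigma (q : 'cV[R]_(N + N + 1)) : 'cV[R]_(N + N + 1) :=
  col_mx (col_mx (- ypart q) (xpart q)) 1%:M.

Definition Amx (q : 'cV[R]_(N + N + 1)) : 'M[R]_(N + N + 1) :=
  sigma q *m (sigma q)^T.

Definition char_op (u : 'cV[R]_(N + N + 1) -> R) (x : 'cV[R]_(N + N + 1)) : R :=
  1 / ((1 + enorm (grad u x) ^+ 2) `^ (3 / 2)) *
  \tr (Amx (grad u x) *m hessian u x).

End Coordinates.

(* [nu] is the inner unit normal at [p] to the boundary of [Om], which is of
   class C^2 near [p]: there [Om] is the set where a C^2 function with
   nonvanishing gradient at [p] is positive. *)
Definition inner_normal (R : realType) (n : nat) (Om : set 'cV[R]_n)
    (p nu : 'cV[R]_n) : Prop :=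
  exists (U : set 'cV[R]_n) (phi : 'cV[R]_n -> R),
    [/\ open U /\ U p,
        C2_on U phi,
        phi p = 0 /\ grad phi p <> 0,
        Om `&` U = [set x | 0 < phi x] `&` U &
        nu = (enorm (grad phi p))^-1 *: grad phi p].

(* One-sided, hence meaningful for a function given only on the closure of an
   open set to which [nu] is an inner normal at [p]. *)
Definition is_inner_deriv (R : realType) (n : nat) (f : 'cV[R]_n -> R)
    (p nu : 'cV[R]_n) (l : R) : Prop :=
  h^-1 * (f (p + h *: nu) - f p) @[h --> 0^'+] --> l.

(* Functions on the closure of [Om] are represented by arbitrary total
   extensions, on whose values elsewhere nothing below depends. *)
Definition hopf_lemma (R : realType) (N : nat) : Prop :=
  forall (Om : set 'cV[R]_(N + N + 1)) (u v : 'cV[R]_(N + N + 1) -> R)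
    (p nu : 'cV[R]_(N + N + 1)) (du dv : R),
    open Om ->
    C2_on Om u -> C2_on Om v ->
    {within closure Om, continuous u} -> {within closure Om, continuous v} ->
    boundary Om p -> inner_normal Om p nu ->
    (forall x, Om x -> char_op v x <= char_op u x) ->
    (forall x, (closure Om `\ p) x -> u x < v x) ->
    u p = v p ->
    is_inner_deriv u p nu du -> is_inner_deriv v p nu dv ->
    du < dv.

Section Counterexample.
Variables (R : realType) (N : nat) (r : R).

(* [Num.sqrt] vanishes on negative numbers; only the values on the closed ball
   of radius [r] matter, where the radicands are nonnegative. *)
Definition u_cyl (x : 'cV[R]_(N + N + 1)) : R :=
  - Num.sqrt (r ^+ 2 - `|x (last_idx N) 0| ^+ 2).

Definition v_sph (x : 'cV[R]_(N + N + 1)) : R :=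
  - Num.sqrt (r ^+ 2 - enorm x ^+ 2).

Definition paraboloid : set 'cV[R]_(N + N + 1) :=
  [set x | \sum_(i | i != first_idx N) x i 0 ^+ 2 - x (first_idx N) 0 < 0].

Definition Omega : set 'cV[R]_(N + N + 1) := eball 0 r `&` paraboloid.

End Counterexample.

(* Main.v *)
Require Import Defs.
From HB Require Import structures.
From mathcomp Require Import all_boot all_order all_algebra.
From mathcomp Require Import all_classical all_reals all_analysis.
From mathcomp Require Import ring.
Import Order.TTheory GRing.Theory Num.Theory.
Import numFieldNormedType.Exports.
Local Open Scope classical_set_scope.
Local Open Scope ring_scope.
Set Implicit Arguments.
Unset Strict Implicit.
Unset Printing Implicit Defensive.

(** Both functions are graphs [- height P r] of the same kind: for a set [P] of
coordinates, the lower half of the surface [sum_(i in P) x_i^2 + z^2 = r^2].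
The sphere [v] takes all coordinates and the cylinder [u] only the last one.
With [s = height P r x], such a graph has gradient [w = x_P / s], where [x_P]
is [x] with the coordinates outside [P] set to zero, and Hessian
[I_P / s + x_P x_P^T / s^3]; moreover [1 + |w|^2 = (r/s)^2]. Hence
[char_op_height]: the characteristic operator takes the value
[(s/r)^3 (|sigma_P|^2 / s + (x . sigma_P)^2 / s^3)] with
[sigma = (-w_y, w_x, 1)].

For the cylinder [sigma_P] reduces to the single entry 1, and the bracket is
[(s^2 + t^2)/s^3 = r^2/s^3]. For the sphere [sigma] is the sum of [e_t] and a
quarter turn of the horizontal part of [w], which is orthogonal to [x]; thus
[x . sigma = t] and [|sigma|^2 = 1 + (|x|^2 - t^2)/s^2], and the bracket is
again [r^2/s^3]. So both functions satisfy [T = 1/r] ([char_op_cyl],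
[char_op_sph]): the operator is too degenerate to distinguish them.

They are ordered because [t^2 <= |x|^2], with equality only where all the other
coordinates vanish; the closed paraboloid [x_2^2 + ... + x_n^2 <= x_1] meets
that line only at the origin ([u_lt_v]). Both have a minimum at the origin,
so both normal derivatives are zero, against the strict inequality of the Hopf
Lemma. *)

(** * Directional derivatives of real functions *)

Section DirectionalDerivatives.
Variable R : realType.

Lemma is_derive_cvg (V : normedModType R) (f : V -> R) (x v : V) (d : R) :
  h^-1 * (f (h *: v + x) - f x) @[h --> 0^'] --> d <-> is_derive x v f d.
Proof.
split=> [fd|[fxv <-]]; last exact: fxv.
by apply: DeriveDef; [apply/cvg_ex; exists d | apply/cvg_lim].
Qed.

(** A directional derivative is an ordinary derivative along the line through
[x] in the direction [v], so that the one-variable chain rule applies to it. *)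
Lemma is_derive_line (V : normedModType R) (f : V -> R) (x v : V) (d : R) :
  is_derive x v f d <-> is_derive (0 : R) 1 (fun h => f (h *: v + x)) d.
Proof.
rewrite -!is_derive_cvg.
have <- // : (fun h : R =>
    h^-1 * (f ((h * 1 + 0 : R) *: v + x) - f ((0 : R) *: v + x)))
  = (fun h => h^-1 * (f (h *: v + x) - f x)).
apply/funext => h; by rewrite addr0 scale0r add0r mulr1.
Qed.

Lemma is_derive_dir_comp (V : normedModType R) (f : R -> R) (g : V -> R)
    (x v : V) (a b : R) :
  is_derive (g x) 1 f a -> is_derive x v g b -> is_derive x v (f \o g) (a * b).
Proof.
move=> fa /is_derive_line gb; apply/is_derive_line.
by apply: is_derive1_comp => //=; rewrite scale0r add0r.
Qed.

(** Covers the coordinates, their partial square norms and affine functions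
at once, and keeps finite sums out of the differentiation rules. *)
Lemma is_derive_quadratic (V : normedModType R) (f : V -> R) (x v : V)
    (d c : R) :
  (forall h : R, f (h *: v + x) = f x + h * d + h ^+ 2 * c) ->
  is_derive x v f d.
Proof.
move=> fE; apply/is_derive_cvg.
(* For nonzero [h] the difference quotient is exactly [d + h * c]. *)
have -> : d = d + 0 * c by rewrite mul0r addr0.
apply: (@cvg_trans _ ((fun h : R => d + h * c) @ 0^'));
  first apply: near_eq_cvg.
  near=> h.
  have h0 : h != 0 by near: h; exact: nbhs_dnbhs_neq.
  by rewrite fE; field.
apply: cvg_within_filter.
apply: cvgD; first exact: cvg_cst.
by apply: cvgM; [exact: cvg_id | exact: cvg_cst].
Unshelve. all: by end_near. Qed.

Lemma near_eq_continuous (V W : topologicalType) (k1 k2 : V -> W) (x : V) :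
  (\near x, k1 x = k2 x) -> {for x, continuous k1} -> {for x, continuous k2}.
Proof.
move=> k12 k1c; rewrite /prop_for /continuous_at -(nbhs_singleton k12).
exact: cvg_trans (near_eq_cvg k12) k1c.
Qed.

Lemma is_derive_inner n (f : 'cV[R]_n -> R) (p nu : 'cV[R]_n) (l : R) :
  is_derive p nu f l -> is_inner_deriv f p nu l.
Proof.
move=> /is_derive_cvg fl; apply: cvg_dnbhs_at_right.
by under eq_fun => h do rewrite (addrC p).
Qed.

End DirectionalDerivatives.

(** * Second order jets *)

(** The operators [grad] and [hessian] are total, so iterating them is
meaningless until the first partial derivatives are known near each point. A
jet on an open set provides them in closed form: [g i] is the derivative of [f]
in the direction [i], and [h j i] that of [g i] in the direction [j]. *)
Definition C2_jet (R : realType) (n : nat) (A : set 'cV[R]_n)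
    (f : 'cV[R]_n -> R) (g : 'I_n -> 'cV[R]_n -> R)
    (h : 'I_n -> 'I_n -> 'cV[R]_n -> R) : Prop :=
  forall x, A x ->
    {for x, continuous f} /\
    forall i : 'I_n,
      [/\ is_derive x (basis_vec R i) f (g i x), {for x, continuous (g i)} &
        forall j : 'I_n,
          is_derive x (basis_vec R j) (g i) (h j i x) /\
          {for x, continuous (h j i)}].

Section Jets.
Variables (R : realType) (n : nat) (A : set 'cV[R]_n) (f : 'cV[R]_n -> R).
Variables (g : 'I_n -> 'cV[R]_n -> R) (h : 'I_n -> 'I_n -> 'cV[R]_n -> R).
Hypotheses (oA : open A) (fgh : C2_jet A f g h).

Lemma jet_partial x i : A x -> partial i f x = g i x.
Proof. by move=> /fgh[_ /(_ i)[+ _ _]] => /(@derive_val _ _ _ _ _ _ _). Qed.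

Lemma near_jet_partial x i : A x -> \near x, g i x = partial i f x.
Proof.
move=> Ax; near=> y; apply/esym/jet_partial.
by near: y; exact: open_nbhs_nbhs.
Unshelve. all: by end_near. Qed.

(** Openness of [A] makes [partial i f] and [g i] agree near [x], not only
at [x], which is what a second differentiation needs. *)
Lemma is_derive_jet_partial x i j : A x ->
  is_derive x (basis_vec R j) (partial i f) (h j i x).
Proof.
move=> Ax; apply: (near_eq_is_derive (near_jet_partial i Ax)).
by have [_ /(_ i)[_ _ /(_ j)[]]] := fgh Ax.
Qed.

Lemma near_jet_partial2 x i j : A x ->
  \near x, h j i x = partial j (partial i f) x.
Proof.
move=> Ax; near=> y.
have Ay : A y by near: y; exact: open_nbhs_nbhs.
by have /(@derive_val _ _ _ _ _ _ _) := is_derive_jet_partial i j Ay.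
Unshelve. all: by end_near. Qed.

Lemma jet_C2_on : C2_on A f.
Proof.
move=> x Ax; have [fc fj] := fgh Ax; split=> // i.
have [fi gc gj] := fj i; split=> [||j].
- exact: ex_derive.
- exact: near_eq_continuous (near_jet_partial i Ax) gc.
- have [_ hc] := gj j; split; last first.
    exact: near_eq_continuous (near_jet_partial2 i j Ax) hc.
  by have [] := is_derive_jet_partial i j Ax.
Qed.

Lemma jet_grad x : A x -> grad f x = \col_i g i x.
Proof. by move=> Ax; apply/matrixP=> i j; rewrite !mxE jet_partial. Qed.

Lemma jet_hessian x : A x -> hessian f x = \matrix_(i, j) h i j x.
Proof.
move=> Ax; apply/matrixP=> i j; rewrite !mxE.
by rewrite -(nbhs_singleton (near_jet_partial2 j i Ax)).
Qed.

End Jets.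

(** * Square norms over a set of coordinates *)

Section PartialSquareNorm.
Variables (R : realType) (n : nat) (P : pred 'I_n).
Implicit Types (x v : 'cV[R]_n).

Definition sqn x : R := \sum_(i | P i) x i 0 ^+ 2.

Lemma continuous_sqn : continuous sqn.
Proof.
apply: continuous_big => [|i _ x]; first exact: add_continuous.
by apply: (@cvgM _ _ (nbhs x)); exact: coord_continuous.
Qed.

Lemma is_derive_coord i x v : is_derive x v (fun y => y i 0) (v i 0).
Proof.
by apply: (@is_derive_quadratic _ _ _ _ _ _ 0) => h; rewrite !mxE; ring.
Qed.

Lemma is_derive_sqn x v :
  is_derive x v sqn (\sum_(i | P i) 2 * (x i 0 * v i 0)).
Proof.
apply: (@is_derive_quadratic _ _ _ _ _ _ (sqn v)) => h.
rewrite /sqn !mulr_sumr -!big_split /=; apply: eq_bigr => i _.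
by rewrite !mxE; ring.
Qed.

Lemma is_derive_sqn_basis x j :
  is_derive x (basis_vec R j) sqn (2 * ((P j)%:R * x j 0)).
Proof.
apply: is_derive_eq; first exact: is_derive_sqn.
rewrite big_mkcond (bigD1 j) //= big1 => [|i /negPf ij]; last first.
  by rewrite !mxE ij mulr0 mulr0 if_same.
by rewrite mxE !eqxx addr0 mulr1; case: (P j); rewrite ?mul1r ?mul0r ?mulr0.
Qed.

End PartialSquareNorm.

(** * Spherical cylinders as graphs *)

Section RoundGraphs.
Variables (R : realType) (n : nat) (P : pred 'I_n) (r : R).
Implicit Types (x : 'cV[R]_n).

Definition height x : R := Num.sqrt (r ^+ 2 - sqn P x).

(** The region where the radicand is positive, that is, where [height] is
smooth. *)
Definition cyl_domain : set 'cV[R]_n := [set x | sqn P x < r ^+ 2].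

(** The derivatives are those of [- height], not of [height]. *)
Definition height_grad (i : 'I_n) x : R := (P i)%:R * x i 0 / height x.

Definition height_hess (j i : 'I_n) x : R :=
  (P i)%:R * (j == i)%:R / height x
  + (P j)%:R * x j 0 * ((P i)%:R * x i 0) / height x ^+ 3.

Lemma open_cyl_domain : open cyl_domain.
Proof.
apply: (@open_comp _ _ (sqn P) [set y | y < r ^+ 2]); last exact: open_lt.
by move=> x _; exact: continuous_sqn.
Qed.

Lemma continuous_height : continuous height.
Proof.
move=> x; apply: (@continuous_comp _ _ _ (fun y => r ^+ 2 - sqn P y) Num.sqrt).
  by apply: (@cvgB _ _ _ (nbhs x)); [exact: cvg_cst | exact: continuous_sqn].
exact: sqrt_continuous.
Qed.

Lemma height_gt0 x : cyl_domain x -> 0 < height x.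
Proof. by move=> Ax; rewrite sqrtr_gt0 subr_gt0. Qed.

Lemma sqr_height x : cyl_domain x -> height x ^+ 2 = r ^+ 2 - sqn P x.
Proof. by move=> Ax; rewrite sqr_sqrtr// subr_ge0 ltW. Qed.

Lemma is_derive_height x j : cyl_domain x ->
  is_derive x (basis_vec R j) height (- ((P j)%:R * x j 0 / height x)).
Proof.
move=> Ax; have h0 := height_gt0 Ax.
have dq : is_derive x (basis_vec R j) (fun y => r ^+ 2 - sqn P y)
    (0 - 2 * ((P j)%:R * x j 0)).
  by apply: is_deriveB; exact: is_derive_sqn_basis.
have ds : is_derive (r ^+ 2 - sqn P x) 1 Num.sqrt (2 * height x)^-1.
  by apply: is_derive1_sqrt; rewrite subr_gt0.
have D := is_derive_dir_comp (g := fun y => r ^+ 2 - sqn P y) ds dq.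
apply: (is_derive_eq D).
by field; rewrite gt_eqF.
Qed.

Lemma is_derive_height_grad x i j : cyl_domain x ->
  is_derive x (basis_vec R j) (height_grad i) (height_hess j i x).
Proof.
move=> Ax; have h0 := height_gt0 Ax.
have di : is_derive (height x) 1 (fun y : R => y^-1)
    (- (height x) ^- 2 *: (1 : R)).
  by apply: (@is_deriveV _ id); rewrite ?gt_eqF//; exact: is_derive_id.
have dV := is_derive_dir_comp (g := height) di (is_derive_height j Ax).
have dx : is_derive x (basis_vec R j) (fun y => (P i)%:R * y i 0)
    ((P i)%:R * (basis_vec R j) i 0).
  by apply: is_deriveZ; exact: is_derive_coord.
have D := is_deriveM dx dV; apply: (is_derive_eq D).
rewrite /height_hess /basis_vec mxE eqxx andbT (eq_sym j) /=.
rewrite -![_ *: _]/(_ * _).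
by field; rewrite gt_eqF.
Qed.

Lemma height_jet :
  C2_jet cyl_domain (fun x => - height x) height_grad height_hess.
Proof.
move=> x Ax; have h0 := height_gt0 Ax.
have hN0 : height x != 0 by rewrite gt_eqF.
have hc : height y @[y --> x] --> height x by exact: continuous_height.
have cc i : (fun y : 'cV[R]_n => (P i)%:R * y i 0) y @[y --> x]
    --> (P i)%:R * x i 0.
  by apply: (@cvgM _ _ (nbhs x)); [exact: cvg_cst | exact: coord_continuous].
split=> [|i]; first by apply: (@cvgN _ _ _ (nbhs x)).
split=> [||j].
- apply: is_derive_eq; first exact: (is_deriveN (is_derive_height i Ax)).
  by rewrite opprK.
- by apply: (@cvgM _ _ (nbhs x)) => //; apply: (@cvgV _ _ (nbhs x)).
- split; first exact: is_derive_height_grad.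
  apply: (@cvgD _ _ _ (nbhs x)); apply: (@cvgM _ _ (nbhs x)).
  + exact: cvg_cst.
  + by apply: (@cvgV _ _ (nbhs x)).
  + by apply: (@cvgM _ _ (nbhs x)); exact: cc.
  + apply: (@cvgV _ _ (nbhs x)); first by rewrite expf_neq0.
    exact: (@cvg_comp _ _ _ height (fun y => y ^+ 3) _ _ _ hc
             (@exprn_continuous _ 3 _)).
Qed.

Lemma height_C2 : C2_on cyl_domain (fun x => - height x).
Proof. exact: jet_C2_on open_cyl_domain height_jet. Qed.

Lemma sqr_enorm x : enorm x ^+ 2 = sqn predT x.
Proof. by rewrite sqr_sqrtr// sumr_ge0// => i _; exact: sqr_ge0. Qed.

(** The area element of a graph in a sphere of radius [r] is [r / height],
and only the coordinates in [P] contribute to the gradient. *)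
Lemma enorm_grad_height x : cyl_domain x ->
  1 + enorm (grad (fun y => - height y) x) ^+ 2 = (r / height x) ^+ 2.
Proof.
move=> Ax; have hN0 : height x != 0 by rewrite gt_eqF// height_gt0.
rewrite sqr_enorm (jet_grad height_jet)// /sqn.
under eq_bigr do rewrite mxE /height_grad expr_div_n exprMn.
rewrite -mulr_suml.
have -> : \sum_i ((P i)%:R ^+ 2 * x i 0 ^+ 2) = sqn P x :> R.
  rewrite /sqn [RHS]big_mkcond; apply: eq_bigr => i _.
  by case: (P i); rewrite ?expr1n ?mul1r // expr0n mul0r.
have -> : sqn P x = r ^+ 2 - height x ^+ 2.
  by rewrite sqr_height// opprB addrC subrK.
by field.
Qed.

End RoundGraphs.

(** * The characteristic operator on these graphs *)

Section CharacteristicOperator.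
Variables (R : realType) (N : nat) (r : R).
Hypothesis r0 : 0 < r.
Implicit Types (P : pred 'I_(N + N + 1)) (x q : 'cV[R]_(N + N + 1)).

Lemma powR_sqr_3half (a : R) : 0 <= a -> (a ^+ 2) `^ (3 / 2) = a ^+ 3.
Proof.
move=> a0; rewrite -(powR_mulrn 2)// -powRrM mulrCA divff// mulr1.
exact: (powR_mulrn 3).
Qed.

Lemma trace_Amx q (H : 'M[R]_(N + N + 1)) :
  \tr (Amx q *m H) = \sum_j (\sum_i sigma q i 0 * H i j) * sigma q j 0.
Proof.
rewrite /Amx -mulmxA mxtrace_mulC trace_mx11 mxE; apply: eq_bigr => j _.
by rewrite mxE; congr (_ * _); apply: eq_bigr => i _; rewrite mxE.
Qed.

(** The trace is the quadratic form of the Hessian [I_P / s + x_P x_P^T / s^3]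
at [sigma]: the diagonal part gives the first sum and the rank one part the
square; the prefactor is the inverse cube of the area element. *)
Lemma char_op_height P x : cyl_domain P r x ->
  let f := fun y => - height P r y in
  char_op f x =
  (height P r x / r) ^+ 3 *
  ((\sum_(i | P i) sigma (grad f x) i 0 ^+ 2) / height P r x
   + (\sum_(i | P i) x i 0 * sigma (grad f x) i 0) ^+ 2 / height P r x ^+ 3).
Proof.
move=> Ax f; have H0 := height_gt0 Ax.
rewrite /char_op enorm_grad_height// powR_sqr_3half ?divr_ge0 ?ltW//.
rewrite div1r -exprVn invf_div trace_Amx.
rewrite (jet_hessian (@open_cyl_domain _ _ P r) (@height_jet _ _ P r))//.
congr (_ * _); set s := sigma _; set H := height P r x.
have SE : \sum_(i | P i) x i 0 * s i 0 = \sum_i (P i)%:R * x i 0 * s i 0.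
  rewrite big_mkcond; apply: eq_bigr => i _.
  by case: (P i); rewrite ?mul1r ?mul0r.
rewrite SE; set S := \sum_i (P i)%:R * x i 0 * s i 0.
have rowE j : \sum_i s i 0 * (\matrix_(i, j) height_hess P r i j x) i j
    = (P j)%:R * s j 0 / H + S * ((P j)%:R * x j 0 / H ^+ 3).
  under eq_bigr => i _ do rewrite mxE mulrDr.
  rewrite big_split /=; congr (_ + _).
    rewrite (bigD1 j)//= big1 ?eqxx ?addr0 => [|i /negPf ->].
      by rewrite mulr1 -/H; ring.
    by rewrite mulr0 mul0r mulr0.
  by rewrite mulr_suml; apply: eq_bigr => i _; rewrite -/H; ring.
under eq_bigr => j _ do rewrite rowE mulrDl.
rewrite big_split /=; congr (_ + _).
  rewrite mulr_suml [RHS]big_mkcond; apply: eq_bigr => j _.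
  by case: (P j) => /=; rewrite ?mul0r//; ring.
rewrite expr2 -mulrA [S / _]mulr_suml mulr_sumr; apply: eq_bigr => j _; ring.
Qed.

Lemma sigma_x q (k : 'I_N) :
  sigma q (lshift 1 (lshift N k)) 0 = - q (lshift 1 (rshift N k)) 0.
Proof. by rewrite /sigma col_mxEu col_mxEu !mxE. Qed.

Lemma sigma_y q (k : 'I_N) :
  sigma q (lshift 1 (rshift N k)) 0 = q (lshift 1 (lshift N k)) 0.
Proof. by rewrite /sigma col_mxEu col_mxEd !mxE. Qed.

Lemma sigma_t q : sigma q (last_idx N) 0 = 1.
Proof. by rewrite /sigma /last_idx col_mxEd mxE. Qed.

Lemma sum_coords (F : 'I_(N + N + 1) -> R) :
  \sum_i F i = \sum_(k < N) F (lshift 1 (lshift N k))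
             + \sum_(k < N) F (lshift 1 (rshift N k)) + F (last_idx N).
Proof. by rewrite big_split_ord big_split_ord /= big_ord1. Qed.

Lemma u_cylE : u_cyl r = fun x => - height (pred1 (last_idx N)) r x.
Proof.
apply/funext => x; rewrite /u_cyl /height /sqn big_pred1_eq.
by rewrite real_normK ?num_real.
Qed.

Lemma v_sphE : v_sph r = fun x : 'cV[R]_(N + N + 1) => - height predT r x.
Proof. by apply/funext => x; rewrite /v_sph /height sqr_enorm. Qed.

(** Only the entry [sigma_t = 1] is selected, and [s^2 + t^2 = r^2]. *)
Lemma char_op_cyl x : cyl_domain (pred1 (last_idx N)) r x ->
  char_op (u_cyl r) x = r^-1.
Proof.
move=> Ax; have H0 := height_gt0 Ax.
rewrite u_cylE char_op_height// !big_pred1_eq sigma_t.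
have := sqr_height Ax; rewrite /sqn big_pred1_eq; set H := height _ _ _ => HE.
have -> : (x (last_idx N) 0 * 1) ^+ 2 = r ^+ 2 - H ^+ 2 by rewrite HE; ring.
by field; rewrite !gt_eqF.
Qed.

(** The quarter turn in [sigma] makes the horizontal terms of [x . sigma]
cancel in pairs, leaving [t], while they add up in [|sigma|^2]. *)
Lemma char_op_sph x : cyl_domain predT r x -> char_op (v_sph r) x = r^-1.
Proof.
move=> Ax; have H0 := height_gt0 Ax.
rewrite v_sphE char_op_height// (jet_grad (@height_jet _ _ predT r))//.
have := sqr_height Ax; rewrite /sqn !sum_coords !sigma_t.
set H := height _ _ _ => HE.
under eq_bigr do rewrite sigma_x mxE /height_grad mul1r sqrrN expr_div_n.
under [X in _ + X + _]eq_bigr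
  do rewrite sigma_y mxE /height_grad mul1r expr_div_n.
under [X in (X + _ + _ * 1) ^+ 2]eq_bigr
  do rewrite sigma_x mxE /height_grad mul1r.
under [X in (_ + X + _ * 1) ^+ 2]eq_bigr
  do rewrite sigma_y mxE /height_grad mul1r.
rewrite -!mulr_suml -/H.
have -> :
    \sum_(k < N) x (lshift 1 (lshift N k)) 0 * - (x (lshift 1 (rshift N k)) 0 / H)
    = - \sum_(k < N) x (lshift 1 (rshift N k)) 0 * (x (lshift 1 (lshift N k)) 0 / H).
  by rewrite -sumrN; apply: eq_bigr => k _; ring.
rewrite addNr add0r mulr1.
set a := \sum_(k < N) _ in HE *; set b := \sum_(k < N) _ in HE *.
have -> : x (last_idx N) 0 ^+ 2 = r ^+ 2 - H ^+ 2 - a - b by rewrite HE; ring.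
by field; rewrite !gt_eqF.
Qed.

End CharacteristicOperator.

(** * The domain between the ball and the paraboloid *)

Section ParaboloidDomain.
Variables (R : realType) (N : nat).
Hypothesis hN : (1 <= N)%N.
Local Notation n := (N + N + 1)%N.
Local Notation e1 := (basis_vec R (first_idx N)).
Local Notation off_axis := (predC1 (first_idx N)).
Implicit Types (x : 'cV[R]_n) (r : R) (P : pred 'I_n).

(** The place where [1 <= N] matters: for [N = 0] the cylinder would be the
sphere itself. *)
Lemma first_neq_last : first_idx N != last_idx N.
Proof. by rewrite -val_eqE /= addn0 eq_sym -lt0n addn_gt0 hN. Qed.

(** The defining function of the paraboloid, positive inside, so that its
gradient is an inner normal. *)
Definition parab x : R := x (first_idx N) 0 - sqn off_axis x.

Lemma paraboloidE : @paraboloid R N = [set x | 0 < parab x].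
Proof.
by apply/seteqP; split => x; rewrite /paraboloid /parab /= subr_lt0 subr_gt0.
Qed.

Lemma continuous_parab : continuous parab.
Proof.
move=> x; apply: (@cvgB _ _ _ (nbhs x)); first exact: coord_continuous.
exact: continuous_sqn.
Qed.

Lemma parab_jet : C2_jet setT parab
  (fun i x => (i == first_idx N)%:R - 2 * ((off_axis i)%:R * x i 0))
  (fun j i x => 0 - 2 * ((off_axis i)%:R * (i == j)%:R)).
Proof.
move=> x _; split=> [|i]; first exact: continuous_parab.
split=> [||j].
- have D := is_deriveB (is_derive_coord (first_idx N) x (basis_vec R i))
    (is_derive_sqn_basis off_axis x i).
  by apply: (is_derive_eq D); rewrite /basis_vec mxE eqxx andbT eq_sym.
- apply: (@cvgB _ _ _ (nbhs x)); first exact: cvg_cst.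
  apply: (@cvgM _ _ (nbhs x)); first exact: cvg_cst.
  by apply: (@cvgM _ _ (nbhs x)); [exact: cvg_cst | exact: coord_continuous].
- split; last exact: (@cvg_cst _ _ _ (nbhs x)).
  apply: (@is_derive_quadratic _ _ _ _ _ _ 0) => h.
  by rewrite /basis_vec !mxE eqxx andbT; ring.
Qed.

Lemma grad_parab0 : grad parab 0 = e1.
Proof.
rewrite (jet_grad parab_jet)//; apply/matrixP => i j.
by rewrite !mxE ord1 eqxx andbT !mulr0 subr0.
Qed.

Lemma enorm_e1 : enorm e1 = 1.
Proof.
rewrite /enorm (bigD1 (first_idx N))//= big1 => [|i /negPf ij].
  by rewrite mxE !eqxx expr1n addr0 sqrtr1.
by rewrite mxE ij expr0n.
Qed.

Lemma sqn_le P x : sqn P x <= sqn predT x.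
Proof.
rewrite /sqn [leLHS]big_mkcond; apply: ler_sum => i _.
by case: (P i) => //; exact: sqr_ge0.
Qed.

Lemma sqn0 P : sqn P (0 : 'cV[R]_n) = 0.
Proof. by rewrite /sqn big1// => i _; rewrite mxE expr0n. Qed.

Lemma sqn_first x : sqn predT x = x (first_idx N) 0 ^+ 2 + sqn off_axis x.
Proof. by rewrite /sqn (bigD1 (first_idx N)). Qed.

Lemma last_le_off_axis x : x (last_idx N) 0 ^+ 2 <= sqn off_axis x.
Proof.
rewrite /sqn (bigD1 (last_idx N)) /=; last by rewrite eq_sym first_neq_last.
by rewrite lerDl sumr_ge0// => i _; exact: sqr_ge0.
Qed.

Lemma eballE r : 0 < r -> eball (0 : 'cV[R]_n) r = cyl_domain predT r.
Proof.
move=> r0; apply/seteqP; split => x;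
  rewrite /eball /cyl_domain /= subr0 -sqr_enorm.
  by rewrite ltr_sqr ?nnegrE ?sqrtr_ge0 ?ltW.
by rewrite ltr_sqr ?nnegrE ?sqrtr_ge0 ?ltW.
Qed.

Lemma OmegaE r : 0 < r ->
  Omega r = cyl_domain predT r `&` [set x | 0 < parab x].
Proof. by move=> r0; rewrite /Omega eballE// paraboloidE. Qed.

Lemma Omega_cyl_domain r P : 0 < r -> Omega r `<=` cyl_domain P r.
Proof.
by move=> r0; rewrite OmegaE// => x [+ _]; exact: le_lt_trans (sqn_le _ _).
Qed.

Lemma open_Omega r : 0 < r -> open (@Omega R N r).
Proof.
move=> r0; rewrite OmegaE//; apply: openI; first exact: open_cyl_domain.
apply: (@open_comp _ _ parab [set y | 0 < y]); last exact: open_gt.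
by move=> x _; exact: continuous_parab.
Qed.

Lemma closure_Omega r x : 0 < r -> closure (Omega r) x ->
  sqn predT x <= r ^+ 2 /\ sqn off_axis x <= x (first_idx N) 0.
Proof.
move=> r0.
have cl : closed ([set x : 'cV[R]_n | sqn predT x <= r ^+ 2] `&`
                  [set x | 0 <= parab x]).
  apply: closedI.
    by apply: (@preimage_closed _ _ (sqn predT) [set y | y <= r ^+ 2]);
      [move=> y _; exact: continuous_sqn | exact: closed_le].
  by apply: (@preimage_closed _ _ parab [set y | 0 <= y]);
    [move=> y _; exact: continuous_parab | exact: closed_ge].
have sub : Omega r `<=` [set x : 'cV[R]_n | sqn predT x <= r ^+ 2] `&`
                  [set x | 0 <= parab x].
  by rewrite OmegaE// => y [yr yp]; split; exact: ltW.
move=> /(closure_subset sub); rewrite -(closure_id _).1// => -[xr xp].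
by split=> //; rewrite -subr_ge0.
Qed.

Lemma boundary_Omega r : 0 < r -> boundary (@Omega R N r) 0.
Proof.
move=> r0; split; last first.
  move=> /interior_subset; rewrite OmegaE// => -[_].
  by rewrite /parab /= sqn0 mxE subr0 ltxx.
move=> B B0.
(* The origin is approached from inside along the positive first axis. *)
have e1B : \forall h \near (0 : R)^'+, B (h *: e1).
  have : h *: e1 @[h --> (0 : R)^'+] --> (0 : 'cV[R]_n).
    rewrite -(scale0r e1); apply: cvgZr_tmp; exact/cvg_at_right_filter/cvg_id.
  by apply.
have [h [h0 hr Bh]] : exists h, [/\ 0 < h, h < r & B (h *: e1)].
  near (0 : R)^'+ => h; exists h; split.
  - by near: h; exact: nbhs_right_gt.
  - by near: h; exact: nbhs_right_lt.
  - by near: h.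
exists (h *: e1); split=> //; rewrite OmegaE//.
have q0 : sqn off_axis (h *: e1) = 0.
  by rewrite /sqn big1// => i /negPf i1; rewrite !mxE i1 mulr0 expr0n.
rewrite /cyl_domain /parab /= sqn_first q0 !mxE !eqxx mulr1 addr0 subr0.
by split=> //; rewrite ltr_sqr ?nnegrE ?ltW.
Unshelve. all: by end_near. Qed.

Lemma inner_normal_Omega r : 0 < r -> inner_normal (@Omega R N r) 0 e1.
Proof.
move=> r0; exists (cyl_domain predT r), parab; split.
- split; first exact: open_cyl_domain.
  by rewrite /cyl_domain /= sqn0 exprn_gt0.
- by move=> x _; exact: (jet_C2_on openT parab_jet).
- split; first by rewrite /parab sqn0 mxE subr0.
  rewrite grad_parab0 => e0; have := enorm_e1; rewrite e0 /enorm big1.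
    by rewrite sqrtr0 => /esym/eqP; rewrite oner_eq0.
  by move=> i _; rewrite mxE expr0n.
- by rewrite OmegaE// -setIA setIC -setIA setIid.
- by rewrite grad_parab0 enorm_e1 invr1 scale1r.
Qed.

(** In the closed paraboloid a point with [x_1 = 0] is the origin; elsewhere
[x_1^2 > 0] makes [t^2 < |x|^2] strict. The radicand of [u] is then positive,
even on the sphere, where that of [v] vanishes. *)
Lemma u_lt_v r x : 0 < r -> (closure (Omega r) `\ 0) x ->
  u_cyl r x < v_sph r x.
Proof.
move=> r0 [/(closure_Omega r0)[xr xp] x0].
have x1 : 0 < x (first_idx N) 0.
  have q0 : 0 <= sqn off_axis x by apply: sumr_ge0 => i _; exact: sqr_ge0.
  rewrite lt_neqAle (le_trans q0 xp) andbT; apply/eqP => x1.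
  have /psumr_eq0P qi : sqn off_axis x = 0 by apply/le_anti; rewrite q0 x1 xp.
  apply: x0; apply/matrixP => i j; rewrite ord1 mxE.
  have [->//|i1] := eqVneq i (first_idx N).
  by apply/eqP; rewrite -sqrf_eq0 qi// => k _; exact: sqr_ge0.
have lt_t : x (last_idx N) 0 ^+ 2 < sqn predT x.
  by rewrite sqn_first (le_lt_trans (last_le_off_axis x))// ltrDr exprn_gt0.
rewrite u_cylE v_sphE ltrN2 ltr_sqrt /sqn big_pred1_eq.
  by rewrite ltrD2l ltrN2.
by rewrite subr_gt0 (lt_le_trans lt_t).
Qed.

Lemma is_derive_height0 P r : 0 < r ->
  is_derive 0 e1 (fun x => - height P r x) 0.
Proof.
move=> r0.
have A0 : cyl_domain P r (0 : 'cV[R]_n) by rewrite /cyl_domain /= sqn0 exprn_gt0.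
have [_ /(_ (first_idx N))[D _ _]] := height_jet A0.
by apply: (is_derive_eq D); rewrite /height_grad mxE mulr0 mul0r.
Qed.

Lemma Omega_counterexample r : 0 < r ->
  let u : 'cV[R]_n -> R := u_cyl r in
  let v : 'cV[R]_n -> R := v_sph r in
  let Om : set 'cV[R]_n := Omega r in
  (boundary Om 0 /\ inner_normal Om 0 e1) /\
  (C2_on Om u /\ C2_on Om v) /\
  (forall x, Om x -> char_op v x <= char_op u x) /\
  (forall x, (closure Om `\ 0) x -> u x < v x) /\
  u 0 = v 0 /\
  is_derive 0 e1 u 0 /\ is_derive 0 e1 v 0.
Proof.
move=> r0 u v Om.
split; first by split; [exact: boundary_Omega | exact: inner_normal_Omega].
split; first split.
- move=> x Ox; rewrite /u u_cylE; apply: height_C2; exact: Omega_cyl_domain Ox.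
- move=> x Ox; rewrite /v v_sphE; apply: height_C2; exact: Omega_cyl_domain Ox.
split.
  move=> x Ox; rewrite char_op_sph ?char_op_cyl//; exact: Omega_cyl_domain Ox.
split; first by move=> x; exact: u_lt_v.
split; first by rewrite /u /v u_cylE v_sphE /height !sqn0.
by rewrite /u /v u_cylE v_sphE; split; exact: is_derive_height0.
Qed.

(** On the domain with [r = 1] the Hopf Lemma would give [0 < 0]. *)
Lemma hopf_lemma_fails : ~ hopf_lemma R N.
Proof.
move=> hopf; have r0 : (0 : R) < 1 by [].
have [[bd nor] [[uC vC] [Tuv [uv [uv0 [du dv]]]]]] := Omega_counterexample r0.
have cont P :
    {within closure (@Omega R N 1), continuous (fun x => - height P 1 x)}.
  apply: continuous_subspaceT => x.
  apply: (@cvgN _ _ _ (nbhs x)); exact: continuous_height.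
have := hopf _ _ _ _ _ 0 0 (open_Omega r0) uC vC _ _ bd nor Tuv uv uv0
  (is_derive_inner du) (is_derive_inner dv).
rewrite u_cylE v_sphE ltxx => /(_ (cont _) (cont _)); exact: notF.
Qed.

End ParaboloidDomain.

Unset Implicit Arguments.

Theorem mainTheorem7 (R : realType) (N : nat) (hN : (1 <= N)%N) :
  ~ hopf_lemma R N /\
  forall r : R, 0 < r ->
    let u : 'cV[R]_(N + N + 1) -> R := u_cyl r in
    let v : 'cV[R]_(N + N + 1) -> R := v_sph r in
    let Om : set 'cV[R]_(N + N + 1) := Omega r in
    let p : 'cV[R]_(N + N + 1) := 0 in
    let nu : 'cV[R]_(N + N + 1) := basis_vec R (first_idx N) in
    (boundary Om p /\ inner_normal Om p nu) /\
    (C2_on Om u /\ C2_on Om v) /\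
    (forall x, Om x -> char_op v x <= char_op u x) /\
    (forall x, (closure Om `\ p) x -> u x < v x) /\
    u p = v p /\
    is_derive p nu u 0 /\ is_derive p nu v 0.
Proof.
split; first exact: hopf_lemma_fails.
by move=> r r0; exact: Omega_counterexample.
Qed.
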